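(* Let $g:[0,\infty)\to[0,\infty)$ be non-decreasing with $g(0)=0$, and consider the Generalized Flow Time Problem. Let $A$ be an online algorithm of class $\mathcal{A}$. Suppose that at every release time $\tau$ (of some job $z$) values $\lambda_j\ge0$ are assigned (possibly re-assigning earlier values) to all jobs released by time $\tau$ such that, with $\gamma_j,\gamma$ computed from the current values: (Q1) if, in the schedule $S_\tau$, $A$ schedules job $j$ at time $t\ge\tau$, then $\gamma_j(t)\ge0$ and $\lambda_j\ge\gamma_{j'}(t)$ for every other job $j'$ pending at $t$; (Q2) if $A$ scheduled job $j$ at time $t<\tau$, then $\gamma_j(t)\ge0$ and $\lambda_j\ge\gamma_{j'}(t)$ for every other job $j'$ pending at $t$, and the schedule of $A$ for $t<\tau$ is not affected by the release of $z$; (Q3) $\gamma(t)=0$ for all $t>C^\tau_{\max}$; and such that the final values $\lambda_j$ together with $\gamma$ form a feasible dual solution (i.e. $\lambda_j\ge0$, $\gamma(t)\ge0$, $\lambda_j-\gamma(t)\le\delta_j g(t-r_j)$ for all $j$, $t\ge r_j$). Then for every $\epsilon>0$, $A$ is a $(1+\epsilon)$-speed $\frac{1+\epsilon}{\epsilon}$-competitive algorithm for integral GFP.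
   Context: Setting: single machine, preemption; job $j$ has release time $r_j\ge0$, processing time $p_j>0$, weight $w_j>0$, revealed at $r_j$; density $\delta_j=w_j/p_j$. A schedule of speed $s$ assigns rates $x_j(t)\ge0$, $x_j(t)=0$ for $t<r_j$, $\sum_j x_j(t)\le s$; $C_j$ is the first time with $\int_{r_j}^{C_j}x_j=p_j$. Integral GFP: minimize $\sum_j w_j g(C_j-r_j)$. An online algorithm (speed 1) is $\alpha$-speed $\beta$-competitive if its cost is at most $\beta$ times the minimum cost over offline schedules of speed $1/\alpha$. Class $\mathcal{A}$: algorithms never idle while jobs are pending and that, at each release time $\tau$, fix an order on the pending set $P_\tau$ and process these jobs one at a time in this order until the next release. $S_\tau$ is the schedule $A$ would produce if no job were released after $\tau$; $C^\tau_{\max}$ is the last completion time of a job of $P_\tau$ in $S_\tau$. Given values $\lambda_j$: $\gamma_j(t)=\lambda_j-\delta_j g(t-r_j)$ for $t\ge r_j$, and $\gamma(t)=\max\{0,\max_{j:r_j\le t}\gamma_j(t)\}$.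
   Formalization: In (Q1) and (Q2) the formal theorem requires λ_j ≥ γ_{j'}(t) for every other job j' released before t, completed or not; with only pending j' the claim is false. A job also counts as scheduled at its completion time, not at its start, which matters if g is discontinuous. *)

(* Defs.v *)
(* MathComp-Analysis, over an abstract R : realType. *)
From HB Require Import structures.
From mathcomp Require Import all_boot all_order all_algebra.
From mathcomp Require Import all_classical all_reals all_analysis.

Set Implicit Arguments.
Unset Strict Implicit.
Unset Printing Implicit Defensive.

Import Order.TTheory GRing.Theory Num.Theory.
Local Open Scope classical_set_scope.
Local Open Scope ring_scope.

(* [name] distinguishes jobs with the same numerical data. *)
Record job (R : realType) := Job {
  name : nat;
  release : R;
  proc : R;
  weight : R }.

Definition job_pack (R : realType) (j : job R) : nat * R * R * R :=
  (name j, release j, proc j, weight j).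
Definition job_unpack (R : realType) (u : nat * R * R * R) : job R :=
  Job u.1.1.1 u.1.1.2 u.1.2 u.2.
Lemma job_packK (R : realType) : cancel (@job_pack R) (@job_unpack R).
Proof. by case. Qed.
HB.instance Definition _ (R : realType) :=
  Equality.copy (job R) (can_type (@job_packK R)).

Section Schedules.
Variable R : realType.
Implicit Types (I J o : seq (job R)) (j z : job R) (x : job R -> R -> R).

Definition instance I : Prop :=
  uniq I /\
  forall j, j \in I -> [/\ 0 <= release j, 0 < proc j & 0 < weight j].

Definition density j : R := weight j / proc j.

Definition is_schedule (s : R) I x : Prop :=
  [/\ forall j, j \in I -> measurable_fun setT (x j),
      forall j t, j \in I -> 0 <= x j t,
      forall j t, j \in I -> t < release j -> x j t = 0
    & forall t, \sum_(j <- I) x j t <= s].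

Definition volume x j (t : R) : \bar R :=
  (\int[lebesgue_measure]_(u in `[release j, t]) (x j u)%:E)%E.

Definition is_completion x j (C : R) : Prop :=
  [/\ release j <= C, volume x j C = (proc j)%:E
    & forall t, release j <= t -> volume x j t = (proc j)%:E -> C <= t].

Definition cost (g : R -> R) I (C : job R -> R) : R :=
  \sum_(j <- I) weight j * g (C j - release j).

(* An online algorithm that takes decisions only at release times: given the
   list of all jobs revealed so far, the last of them at the current time, it
   returns the order in which the pending jobs are processed until the next
   release.  The past schedule is determined by the revealed jobs, so it need
   not be an argument. *)
Definition algorithm := seq (job R) -> seq (job R).

Definition revealed I (t : R) : seq (job R) := [seq j <- I | release j <= t].

Definition released_before I (t : R) : seq (job R) :=
  [seq j <- I | release j < t].

Definition release_times I : seq R := sort <=%R (undup (map (@release R) I)).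

Definition event I (k : nat) : R := nth 0 (release_times I) k.

(* Work that precedes [j] when jobs with remaining processing times [q] are
   processed one at a time in the order [o]. *)
Definition ahead (q : job R -> R) o j : R := \sum_(i <- take (index j o) o) q i.

Definition served (q : job R -> R) o j (d : R) : R :=
  if j \in o then Num.min (q j) (Num.max 0 (d - ahead q o j)) else 0.

Definition order_at (A : algorithm) I (k : nat) : seq (job R) :=
  A (revealed I (event I k)).

(* Remaining processing time of [j] under [A] at the [k]-th release time. *)
Fixpoint residual (A : algorithm) I (k : nat) : job R -> R :=
  match k with
  | 0%N => fun j => proc j
  | k'.+1 => fun j =>
      residual A I k' j
      - served (residual A I k') (order_at A I k') j (event I k'.+1 - event I k')
  end.

(* P_tau, for a release time tau of I *)
Definition pending_set (A : algorithm) I (tau : R) : seq (job R) :=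
  [seq j <- revealed I tau | 0 < residual A I (index tau (release_times I)) j].

Definition start (A : algorithm) I (k : nat) j : R :=
  event I k + ahead (residual A I k) (order_at A I k) j.

(* [A] schedules [j] at [t] in its run on [I].  Processing intervals are
   left-open and right-closed, so [j] is scheduled at its completion time. As
   [g] may be discontinuous, right-open intervals would lose the cost incurred
   at the completion time. *)
Definition scheduled (A : algorithm) I j (t : R) : bool :=
  [exists k : 'I_(size (release_times I)),
    [&& j \in order_at A I k,
        start A I k j < t,
        t <= start A I k j + residual A I k j
      & (k.+1 < size (release_times I))%N ==> (t <= event I k.+1)]].

Definition rate (A : algorithm) I j (t : R) : R := (scheduled A I j t)%:R.

Definition in_class (A : algorithm) : Prop :=
  forall I z, instance I -> z \in I ->
    perm_eq (A (revealed I (release z))) (pending_set A I (release z)).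

(* "At most beta times the minimum cost" is stated as a comparison with every
   offline schedule, so that the minimum need not be attained. *)
Definition competitive (g : R -> R) (A : algorithm) (alpha beta : R) : Prop :=
  forall I, instance I ->
    exists C : job R -> R,
      (forall j, j \in I -> is_completion (rate A I) j (C j)) /\
      forall x (D : job R -> R),
        is_schedule alpha^-1 I x ->
        (forall j, j \in I -> is_completion x j (D j)) ->
        cost g I C <= beta * cost g I D.

Implicit Types (g : R -> R) (lam : job R -> R).

Definition gamma_job g lam j (t : R) : R :=
  lam j - density j * g (t - release j).

Definition gamma g lam J (t : R) : R :=
  \big[Num.max/0]_(j <- J | release j <= t) gamma_job g lam j t.

Definition dual_feasible g lam I (gam : R -> R) : Prop :=
  [/\ forall j, j \in I -> 0 <= lam j,
      forall t, 0 <= gam t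
    & forall j t, j \in I -> release j <= t ->
        lam j - gam t <= density j * g (t - release j)].

(* The requirement on the job [j] scheduled at [t].  Like the maximum in
   [gamma], it ranges over every other job released before [t], completed or
   not: if completed jobs are left out, [gamma] can exceed [lam j] at [t] and
   the competitive bound fails.  The strict inequality matches the left-open
   processing intervals. *)
Definition dominates g lam J j (t : R) : Prop :=
  0 <= gamma_job g lam j t /\
  forall j', j' \in J -> j' != j -> release j' < t ->
    gamma_job g lam j' t <= lam j.

(* S_tau is the run of [A] on [revealed I tau]. *)
Definition Q1 g (A : algorithm) lam I (tau : R) : Prop :=
  let J := revealed I tau in
  forall j t, j \in J -> tau <= t -> scheduled A J j t -> dominates g lam J j t.

Definition Q2 g (A : algorithm) lam I (tau : R) : Prop :=
  let J := revealed I tau in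
  (forall j t, j \in J -> t < tau -> scheduled A I j t ->
     dominates g lam J j t) /\
  (forall j t, j \in J -> t < tau ->
     scheduled A J j t = scheduled A (released_before I tau) j t).

Definition Q3 g (A : algorithm) lam I (tau : R) : Prop :=
  let J := revealed I tau in
  let P := pending_set A I tau in
  forall C : job R -> R,
    (forall j, j \in P -> is_completion (rate A J) j (C j)) ->
    forall t, \big[Num.max/0]_(j <- P) C j < t -> gamma g lam J t = 0.

Definition last_release I : R := \big[Num.max/0]_(j <- I) release j.

End Schedules.

(* Main.v *)
(* Let lam j be the value assigned to j at the last release time of its busy
   period.  By (Q1) and (Q2) lam j dominates every gamma_i while j is
   processed, and by (Q3) the gamma_i are nonpositive when A is idle; hence the
   function sum_j lam j * rate_j is a feasible substitute for gamma and its
   integral is at most S = sum_j lam j * proc j.  Nonnegativity of gamma_j at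
   the completion time of j shows that S is at least the cost of A.  Weak duality
   against a schedule of speed 1 / (1 + eps) bounds the cost of that schedule
   below by S - S / (1 + eps) = eps / (1 + eps) * S. *)
Require Import Defs.
From mathcomp Require Import all_boot all_order all_algebra.
From mathcomp Require Import all_classical all_reals all_analysis.
From mathcomp Require Import measurable_realfun zify ring lra.

Import Order.TTheory GRing.Theory Num.Theory.
Local Open Scope classical_set_scope.
Local Open Scope ring_scope.

(** * Agreement between the run on the revealed jobs and the full run *)

Section Prefix.
Set Implicit Arguments.
Unset Strict Implicit.
Variables (R : realType) (A : algorithm R) (I : seq (job R)).
Local Notation n := (size (release_times I)).
Local Notation ev := (event I).
Implicit Types (j : job R) (k e : nat) (t : R).

Lemma release_times_lt_sorted : sorted <%R (release_times I).
Proof. by rewrite sort_lt_sorted undup_uniq. Qed.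

Lemma event_lt k e : (k < e)%N -> (e < n)%N -> ev k < ev e.
Proof.
move=> ke en; rewrite /event lt_sorted_ltn_nth ?inE //.
  exact: release_times_lt_sorted.
exact: ltn_trans en.
Qed.

Lemma event_le k e : (k <= e)%N -> (e < n)%N -> ev k <= ev e.
Proof.
by rewrite leq_eqVlt => /predU1P[->//|ke en]; apply/ltW/event_lt.
Qed.

Lemma mem_release_times j : j \in I -> release j \in release_times I.
Proof. by move=> jI; rewrite mem_sort mem_undup map_f. Qed.

Lemma event_release k : (k < n)%N -> exists2 z, z \in I & release z = ev k.
Proof.
move=> kn; have: ev k \in release_times I by exact: mem_nth.
by rewrite mem_sort mem_undup => /mapP[z zI ->]; exists z.
Qed.

Lemma index_event k : (k < n)%N -> index (ev k) (release_times I) = k.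
Proof. by move=> kn; rewrite index_uniq ?sort_uniq ?undup_uniq. Qed.

Definition release_index j := index (release j) (release_times I).

Lemma release_index_lt j : j \in I -> (release_index j < n)%N.
Proof. by move=> jI; rewrite index_mem mem_release_times. Qed.

Lemma event_release_index j : j \in I -> ev (release_index j) = release j.
Proof. by move=> jI; rewrite /event nth_index ?mem_release_times. Qed.

Lemma revealed_instance t : instance I -> instance (revealed I t).
Proof.
move=> [Iu Ipos]; split; first exact: filter_uniq.
by move=> j; rewrite mem_filter => /andP[_ /Ipos].
Qed.

(** Both sides are strictly increasing, so it is enough to compare their members. *)
Lemma release_times_revealed e : (e < n)%N ->
  release_times (revealed I (ev e)) = take e.+1 (release_times I).
Proof.
move=> en; apply: (@lt_sorted_eq _ R).
- by rewrite sort_lt_sorted undup_uniq.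
- exact/take_sorted/release_times_lt_sorted.
move=> x; rewrite mem_sort mem_undup.
apply/mapP/idP => [[j]|].
  rewrite mem_filter => /andP[je jI ->].
  rewrite -(event_release_index jI) /event -(nth_take 0 (n0 := e.+1)) ?mem_nth //.
    rewrite size_takel //; rewrite ltnS leqNgt; apply/negP => /event_lt.
    by move=> /(_ (release_index_lt jI)); rewrite event_release_index// ltNge je.
  rewrite ltnS leqNgt; apply/negP => /event_lt.
  by move=> /(_ (release_index_lt jI)); rewrite event_release_index// ltNge je.
move=> /(nthP 0)[k]; rewrite size_takel// => ke <-; rewrite nth_take//.
have [//|z zI ze] := @event_release k; first exact: leq_trans en.
by exists z; rewrite ?ze// mem_filter zI ze event_le.
Qed.

Lemma size_release_times_revealed e : (e < n)%N ->
  size (release_times (revealed I (ev e))) = e.+1.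
Proof. by move=> en; rewrite release_times_revealed// size_takel. Qed.

Lemma event_revealed e k : (e < n)%N -> (k <= e)%N ->
  event (revealed I (ev e)) k = ev k.
Proof.
by move=> en ke; rewrite /event release_times_revealed// nth_take.
Qed.

(** A job revealed at the [k]-th release time is also revealed at the [e]-th, so [A] is given the
    same list in both runs. *)
Lemma order_at_revealed e k : (e < n)%N -> (k <= e)%N ->
  order_at A (revealed I (ev e)) k = order_at A I k.
Proof.
move=> en ke; rewrite /order_at event_revealed//; congr (A _).
rewrite /revealed -filter_predI; apply: eq_filter => j /=.
by rewrite andb_idr// => /le_trans; apply; exact: event_le.
Qed.

Lemma residual_revealed e k : (e < n)%N -> (k <= e)%N ->
  residual A (revealed I (ev e)) k = residual A I k.
Proof.
move=> en; elim: k => // k IHk ke; apply/funext => j /=.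
by rewrite IHk ?order_at_revealed ?event_revealed// ltnW.
Qed.

Lemma start_revealed e k j : (e < n)%N -> (k <= e)%N ->
  start A (revealed I (ev e)) k j = start A I k j.
Proof.
by move=> en ke; rewrite /start event_revealed// residual_revealed// order_at_revealed.
Qed.

End Prefix.

(** * Phases, processing slots and remaining processing times *)

Section Run.
Set Implicit Arguments.
Unset Strict Implicit.
Variables (R : realType) (A : algorithm R) (A_class : in_class A).
Variables (I : seq (job R)) (I_inst : instance I).
Local Notation n := (size (release_times I)).
Local Notation ev := (event I).
Local Notation q := (residual A I).
Local Notation ord := (order_at A I).
Implicit Types (i j : job R) (k e : nat) (t : R).

Lemma order_at_perm k : (k < n)%N -> perm_eq (ord k) (pending_set A I (ev k)).
Proof. by move=> /event_release[z zI zk]; rewrite /order_at -zk; exact: A_class. Qed.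

Lemma mem_order_at k j : (k < n)%N ->
  (j \in ord k) = [&& 0 < q k j, release j <= ev k & j \in I].
Proof.
by move=> kn; rewrite (perm_mem (order_at_perm kn)) !mem_filter index_event.
Qed.

Lemma order_at_uniq k : (k < n)%N -> uniq (ord k).
Proof.
move=> kn; rewrite (perm_uniq (order_at_perm kn)).
by do 2!apply: filter_uniq; case: I_inst.
Qed.

Lemma ahead_ge0 k j : (k < n)%N -> 0 <= ahead (q k) (ord k) j.
Proof.
move=> kn; rewrite /ahead big_seq; apply: sumr_ge0 => i /mem_take.
by rewrite mem_order_at// => /and3P[/ltW].
Qed.

Lemma start_ge k j : (k < n)%N -> ev k <= start A I k j.
Proof. by move=> kn; rewrite lerDl ahead_ge0. Qed.

(** A job outside the order gets an empty slot, so that slots can be summed over all phases without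
    a membership test. *)
Definition finish k j : R :=
  if j \in ord k then
    if (k.+1 < n)%N then Num.min (start A I k j + q k j) (ev k.+1)
    else start A I k j + q k j
  else start A I k j.

Definition in_slot k j t := start A I k j < t <= finish k j.

Lemma scheduledE j t : scheduled A I j t = [exists k : 'I_n, in_slot k j t].
Proof.
apply: eq_existsb => k; rewrite /in_slot /finish; case: ifP => [_|_] /=.
  by case: ifP => _; rewrite ?le_min ?andbT.
by apply/esym/negbTE/negP => /andP[/lt_le_trans h /h]; rewrite ltxx.
Qed.

Lemma finish_le k j : (k.+1 < n)%N -> j \in ord k -> finish k j <= ev k.+1.
Proof. by rewrite /finish => -> ->; rewrite ge_min lexx orbT. Qed.

Lemma in_slot_order k j t : in_slot k j t -> j \in ord k.
Proof.
rewrite /in_slot /finish; case: ifP => // _ /andP[/lt_le_trans h /h].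
by rewrite ltxx.
Qed.

Lemma in_slot_event k j t : (k < n)%N -> in_slot k j t ->
  ev k < t /\ ((k.+1 < n)%N -> t <= ev k.+1).
Proof.
move=> kn h; have jk := in_slot_order h; move: h => /andP[st tf]; split.
  exact: le_lt_trans (start_ge _ kn) st.
by move=> /finish_le/(_ jk); exact: le_trans.
Qed.

(** Phases are left-open and right-closed, hence disjoint; the last one is unbounded. *)
Lemma phase_uniq k k' t : (k < n)%N -> (k' < n)%N ->
  ev k < t -> ((k.+1 < n)%N -> t <= ev k.+1) ->
  ev k' < t -> ((k'.+1 < n)%N -> t <= ev k'.+1) -> k = k'.
Proof.
wlog: k k' / (k <= k')%N.
  move=> H kn k'n a b c d; case: (leqP k k') => [le|/ltnW le]; first exact: H.
  exact/esym/H.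
rewrite leq_eqVlt => /predU1P[//|lt] kn k'n _ tk k't _; exfalso.
have {}tk := tk (leq_ltn_trans lt k'n).
by have := le_lt_trans (event_le lt k'n) (lt_le_trans k't tk); rewrite ltxx.
Qed.

Lemma in_slot_uniq k k' i j t : (k < n)%N -> (k' < n)%N ->
  in_slot k i t -> in_slot k' j t -> k = k'.
Proof.
move=> kn k'n /(in_slot_event kn)[a b] /(in_slot_event k'n)[c d].
exact: phase_uniq a b c d.
Qed.

(** At most one phase contains [t], so the existential in [scheduled] becomes a sum of indicators,
    which can be integrated termwise. *)
Lemma rateE j t : rate A I j t = \sum_(k < n) (in_slot k j t)%:R.
Proof.
rewrite /rate scheduledE; case: existsP => [[k kt]|none].
  rewrite (bigD1 k)//= kt big1 ?addr0// => l lk.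
  case: (boolP (in_slot l j t)) => //= lt.
  by have /val_inj/eqP := in_slot_uniq (ltn_ord l) (ltn_ord k) lt kt; rewrite (negbTE lk).
rewrite big1// => k _; case: (boolP (in_slot k j t)) => //= kt.
by case: none; exists k.
Qed.

(** The truncation at 0 covers a job whose start would fall after the next release. *)
Definition slot_length k j : R := Num.max 0 (finish k j - start A I k j).

Lemma residual_ge0 k j : j \in I -> 0 <= q k j.
Proof.
case: I_inst => _ Ipos jI; elim: k => [|k IHk] /=.
  by have [_ /ltW] := Ipos _ jI.
by rewrite subr_ge0 /served; case: ifP => // _; rewrite ge_min lexx.
Qed.

Lemma slot_length_last k j : (k < n)%N -> (k.+1 < n)%N = false ->
  j \in I -> slot_length k j <= q k j.
Proof.
move=> kn kn1 jI; have := residual_ge0 k jI; rewrite /slot_length /finish kn1.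
by case: ifP => _; rewrite /Num.max; case: ifP; lra.
Qed.

(** [served] measures time from the beginning of the phase, the slot on the absolute axis: for
    [q >= 0], [min q (max 0 (d - a))] is [max 0 (min (a + q) d - a)]. *)
Lemma residualS k j : (k.+1 < n)%N -> q k.+1 j = q k j - slot_length k j.
Proof.
move=> kn; rewrite /= /slot_length /finish kn /served; case: ifP => jk; last first.
  by rewrite subrr maxxx.
have : 0 < q k j by move: jk; rewrite mem_order_at ?(ltnW kn)// => /and3P[].
rewrite /start; move: (q k j) (ahead _ _ _) (ev k) (ev _.+1) => a b c d a0.
by congr (_ - _); rewrite /Num.max /Num.min; do !case: ifP; lra.
Qed.

Lemma sum_slot_length m j : (m < n)%N ->
  \sum_(k < m) slot_length k j = proc j - q m j.
Proof.
elim: m => [|m IHm] mn; first by rewrite big_ord0 subrr.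
rewrite big_ord_recr /= IHm ?(ltnW mn)//.
have := residualS j mn; rewrite /=; lra.
Qed.

Lemma sum_slot_length_le j : j \in I -> \sum_(k < n) slot_length k j <= proc j.
Proof.
move=> jI; have := release_index_lt jI; move: (sum_slot_length (m := n.-1) j).
have := @slot_length_last n.-1 j.
case: n (leqnn n) => // m; rewrite /= => mn h1 h2 _.
rewrite big_ord_recr /= h2//.
have := h1 (ltnSn m) (ltnn _) jI; lra.
Qed.

Lemma residual_nonincr k m j : j \in I -> (k <= m)%N -> (m < n)%N -> q m j <= q k j.
Proof.
move=> jI; elim: m => [|m IHm]; first by rewrite leqn0 => /eqP->.
rewrite leq_eqVlt => /predU1P[->//|km] mn.
apply: le_trans (IHm km (ltnW mn)); rewrite residualS//.
by rewrite gerBl le_max lexx.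
Qed.

Lemma slot_length_before_release k j : (k < n)%N -> ev k < release j ->
  slot_length k j = 0.
Proof.
move=> kn kj; rewrite /slot_length /finish mem_order_at// leNgt kj andbF.
by rewrite subrr maxxx.
Qed.

(** All slots of [j] in earlier phases are empty. *)
Lemma residual_release_index j : j \in I -> q (release_index I j) j = proc j.
Proof.
move=> jI; have rn := release_index_lt jI.
have := sum_slot_length j rn; rewrite big1 => [|k _]; first lra.
apply: slot_length_before_release; first exact: ltn_trans rn.
by rewrite -(event_release_index jI) event_lt.
Qed.

(** * Measures of slots and processed volume *)

Local Notation mu := lebesgue_measure.

Definition slot k j : set R := [set` `]start A I k j, finish k j]].

Lemma measurable_slot k j : measurable (slot k j).
Proof. exact: measurable_itv. Qed.

Lemma rate_indic j t : rate A I j t = \sum_(k < n) \1_(slot k j) t.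
Proof.
rewrite rateE; apply: eq_bigr => k _.
by rewrite indicE /slot mem_setE /in_slot in_itv.
Qed.

Lemma measurable_rate j : measurable_fun setT (rate A I j).
Proof.
rewrite (_ : rate A I j = fun t => \sum_(k < n) \1_(slot k j) t).
  apply: (measurable_sum _ (h := fun k : 'I_n => \1_(slot k j))) => k.
  by apply: measurable_indic; exact: measurable_slot.
by apply/funext => t; exact: rate_indic.
Qed.

Lemma integral_rate (D : set R) j : measurable D ->
  (\int[mu]_(u in D) (rate A I j u)%:E = \sum_(k < n) mu (slot k j `&` D))%E.
Proof.
move=> mD; under eq_integral do rewrite rate_indic -sumEFin.
rewrite ge0_integral_sum//.
- by apply: eq_bigr => k _; rewrite integral_indic//; exact: measurable_slot.
- move=> k; apply/measurable_EFinP; apply: measurable_funTS.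
  by apply: measurable_indic; exact: measurable_slot.
Qed.

Lemma lebesgue_measure_oc (a b : R) :
  mu [set` `]a, b]] = (Num.max 0 (b - a))%:E.
Proof.
rewrite lebesgue_measure_itv /= lte_fin -EFinB /Num.max.
by do 2!case: ifP => //; (move=> h1 h2; congr (_%:E); lra) || lra.
Qed.

Lemma volume_rate j t : j \in I -> release j <= t ->
  volume (rate A I) j t =
  (\sum_(k < n) Num.max 0 (Num.min (finish k j) t - start A I k j))%:E.
Proof.
move=> jI rt; rewrite /volume integral_rate; last exact: measurable_itv.
rewrite -sumEFin; apply: eq_bigr => k _; rewrite -lebesgue_measure_oc.
congr (mu _); apply/seteqP; rewrite /slot; split => u /=; rewrite !in_itv/= le_min.
  by move=> [/andP[-> ->] /andP[_ ->]].
move=> /and3P[su uf ut]; rewrite su uf ut; split => //.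
(* A nonempty slot of [j] lies in a phase that begins after the release of [j], so the left end of
   the integration interval cuts nothing off. *)
rewrite andbT; apply/ltW/le_lt_trans/su.
have : in_slot k j u by rewrite /in_slot su.
move=> /in_slot_order; rewrite mem_order_at// => /and3P[_ rk _].
by apply: le_trans rk _; exact: start_ge.
Qed.

Lemma integral_rate_total j :
  (\int[mu]_u (rate A I j u)%:E = (\sum_(k < n) slot_length k j)%:E)%E.
Proof.
rewrite integral_rate//.
under eq_bigr do rewrite setIT lebesgue_measure_oc.
by rewrite sumEFin.
Qed.

(** A residual that drops to 0 forces the slot to have length [q k j], so the next release does not
    cut it; in the last phase nothing can. *)
Lemma slot_gt0 k j : (k < n)%N -> j \in ord k ->
  ((k.+1 < n)%N -> q k.+1 j = 0) ->
  start A I k j < start A I k j + q k j /\ finish k j = start A I k j + q k j.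
Proof.
move=> kn jk done; have q0 : 0 < q k j by move: jk; rewrite mem_order_at// => /and3P[].
split; first by rewrite ltrDl.
have [kn1|kn1] := boolP (k.+1 < n)%N; last by rewrite /finish jk (negbTE kn1).
have := residualS j kn1; rewrite done// /slot_length /Num.max.
case: ifP => _; lra.
Qed.

(** * Completion times *)

Definition slot_before k j t : R :=
  Num.max 0 (Num.min (finish k j) t - start A I k j).

Lemma slot_before_le k j t u : t <= u -> slot_before k j t <= slot_before k j u.
Proof.
move=> tu; rewrite /slot_before ge_max le_max lexx /= le_max lerB ?orbT//.
by rewrite le_min ge_min lexx ge_min tu orbT.
Qed.

Lemma slot_before_le_length k j t : slot_before k j t <= slot_length k j.
Proof.
rewrite /slot_before /slot_length ge_max le_max lexx /= le_max lerB ?orbT//.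
by rewrite ge_min lexx.
Qed.

Lemma slot_before_full k j t : (j \in ord k -> finish k j <= t) ->
  slot_before k j t = slot_length k j.
Proof.
rewrite /slot_before /slot_length; case: (boolP (j \in ord k)) => [_ /(_ isT)/min_idPl->//|jk _].
by rewrite /finish (negbTE jk) subrr maxxx; apply/max_idPl; rewrite subr_le0 ge_min lexx.
Qed.

(** The slots up to phase [k] add up to [proc j]. At an earlier time the slot of phase [k]
    contributes strictly less and no other slot contributes more, so the end of this slot is the
    first time with full volume. *)
Lemma completion_finish k j : (k < n)%N -> j \in ord k ->
  ((k.+1 < n)%N -> q k.+1 j = 0) -> is_completion (rate A I) j (finish k j).
Proof.
move=> kn jk done; have [st fE] := slot_gt0 kn jk done.
have [_ rj jI] : [/\ 0 < q k j, release j <= ev k & j \in I].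
  by apply/and3P; rewrite -mem_order_at.
have rf : release j <= finish k j.
  by rewrite fE; apply/ltW/(le_lt_trans _ st)/(le_trans rj); exact: start_ge.
have full : \sum_(l < n) slot_before l j (finish k j) = proc j.
  apply/eqP; rewrite eq_le; apply/andP; split.
    apply: le_trans (sum_slot_length_le jI); apply: ler_sum => l _.
    exact: slot_before_le_length.
  have -> : proc j = \sum_(l < k.+1) slot_length l j.
    rewrite big_ord_recr /= sum_slot_length// /slot_length fE.
    by rewrite [_ + q k j]addrC addrK max_r ?subrK// residual_ge0.
  rewrite (big_ord_widen n (fun l => slot_length l j))// big_mkcond.
  apply: ler_sum => l _; case: ifP => [lk|_]; last by rewrite /slot_before le_max lexx.
  rewrite slot_before_full// => jl.
  move: lk; rewrite ltnS leq_eqVlt => /predU1P[->//|lk].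
  apply: (le_trans (finish_le (leq_ltn_trans lk kn) jl)).
  apply: le_trans (event_le lk kn) _; rewrite fE.
  by apply/ltW/(le_lt_trans (start_ge j kn)).
split=> [//||t rt]; first by rewrite volume_rate// full.
rewrite volume_rate// => -[]; rewrite -full => /eqP.
rewrite -[X in X == _]/(\sum_(l < n) slot_before l j t).
apply: contraTT; rewrite -ltNge => tf.
pose K := Ordinal kn; rewrite lt_eqF// (bigD1 K)//= [ltRHS](bigD1 K)//=.
apply: ltr_leD; last by apply: ler_sum => l _; exact/slot_before_le/ltW.
rewrite /slot_before minxx (min_r (ltW tf)) fE.
rewrite [ltRHS]max_r ?subr_ge0 1?ltW// gt_max subr_gt0 st /= ltrD2r.
by rewrite -fE.
Qed.

(** Take the least phase from the release of [j] on that is last or leaves no residual. By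
    minimality the residual is still positive when it begins, so [j] is in its order. *)
Lemma exists_completion j : j \in I -> exists k,
  [/\ (k < n)%N, j \in ord k & ((k.+1 < n)%N -> q k.+1 j = 0)].
Proof.
move=> jI; have rn := release_index_lt jI; set r := release_index I j in rn.
have [_ Ipos] := I_inst; have [_ pj _] := Ipos _ jI.
pose P m := (r <= m)%N && ((m.+1 < n)%N ==> (q m.+1 j == 0)).
have exP : exists m, P m.
  exists n.-1; rewrite /P prednK ?ltnn ?andbT; last exact: leq_ltn_trans rn.
  by rewrite -ltnS prednK//; exact: leq_ltn_trans rn.
case: (ex_minnP exP) => m /andP[rm /implyP mq] minm.
have mn : (m < n)%N.
  apply: (@leq_ltn_trans n.-1); last by rewrite prednK//; exact: leq_ltn_trans rn.
  apply: minm; rewrite /P prednK ?ltnn ?andbT; last exact: leq_ltn_trans rn.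
  by rewrite -ltnS prednK//; exact: leq_ltn_trans rn.
exists m; split => //; last by move/mq/eqP.
rewrite mem_order_at// jI -(event_release_index jI) event_le// !andbT.
move: rm; rewrite leq_eqVlt => /predU1P[<-|]; first by rewrite residual_release_index.
case: m mq minm mn => // m _ minm mn rm.
have : ~~ P m by apply/negP => /minm; rewrite ltnn.
rewrite ltnS in rm; rewrite /P rm mn andTb implyTb => qm.
by rewrite lt_neqAle residual_ge0// andbT eq_sym.
Qed.

(** * Locating a time in its phase, and idle times *)

Lemma phase_exists k0 t : (k0 < n)%N -> ev k0 < t -> exists k,
  [/\ (k < n)%N, (k0 <= k)%N, ev k < t & ((k.+1 < n)%N -> t <= ev k.+1)].
Proof.
move=> k0n k0t; pose P m := (m < n)%N && (ev m < t).
have exP : exists m, P m by exists k0; rewrite /P k0n.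
have bd m : P m -> (m <= n)%N by case/andP => /ltnW.
case: (ex_maxnP exP bd) => k /andP[kn kt] maxk; exists k; split => //.
  by apply: maxk; rewrite /P k0n.
move=> kn1; rewrite leNgt; apply/negP => tk.
by have := maxk k.+1; rewrite /P kn1 tk ltnn => /(_ isT).
Qed.

(** If no slot contains [t], a job started before [t] also ends before [t]. Each job starts when its
    predecessor in the order ends, so induction along the order reaches all of them. *)
Lemma busy_or_done k t : (k < n)%N -> ev k < t ->
  ((k.+1 < n)%N -> t <= ev k.+1) ->
  (exists i, in_slot k i t) \/
  (forall i, i \in ord k ->
     start A I k i + q k i < t /\ ((k.+1 < n)%N -> q k.+1 i = 0)).
Proof.
move=> kn kt tk; have [|idle] := pselect (exists i, in_slot k i t); first by left.
right.
have step i : i \in ord k -> start A I k i < t -> start A I k i + q k i < t.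
  move=> ik st; have : ~~ in_slot k i t by apply/negP => h; apply: idle; exists i.
  rewrite /in_slot st /= -ltNge /finish ik; case: ifP => // kn1.
  by rewrite gt_min => /orP[//|]; rewrite ltNge tk.
have begun m i0 : (m < size (ord k))%N -> start A I k (nth i0 (ord k) m) < t.
  have st l : (l < size (ord k))%N ->
      start A I k (nth i0 (ord k) l) = ev k + \sum_(i <- take l (ord k)) q k i.
    by move=> lo; rewrite /start /ahead index_uniq ?order_at_uniq.
  elim: m => [|m IHm] mo; first by rewrite st// take0 big_nil addr0.
  rewrite st// (take_nth i0) 1?ltnW// -cats1 big_cat big_seq1 /= addrA -st 1?ltnW//.
  by apply: step; rewrite ?mem_nth 1?ltnW// IHm 1?ltnW.
move=> i ik; have it : start A I k i + q k i < t.
  by apply: step => //; rewrite -{1}(nth_index i ik); apply: begun; rewrite index_mem.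
split => // kn1; rewrite residualS// /slot_length /finish ik kn1.
have q0 : 0 < q k i by move: ik; rewrite mem_order_at// => /and3P[].
rewrite min_l; last by apply/ltW/(lt_le_trans it)/tk.
by rewrite [_ + q k i]addrC addrK max_r ?subrr// ltW.
Qed.

End Run.

(** * Busy periods and the substitute for [gamma] *)

Section BusyPeriods.
Set Implicit Arguments.
Unset Strict Implicit.
Variables (R : realType) (A : algorithm R) (A_class : in_class A).
Variables (I : seq (job R)) (I_inst : instance I).
Local Notation n := (size (release_times I)).
Local Notation ev := (event I).
Local Notation q := (residual A I).
Local Notation ord := (order_at A I).
Local Notation in_slot := (in_slot A I).
Local Notation finish := (finish A I).
Implicit Types (i j : job R) (k e : nat) (t : R).

(** Phase [e] is the last one of the run on the revealed jobs, so no slot in it is cut. This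
    supplies the completion times that Q3 asks for. *)
Lemma completion_revealed e i : (e < n)%N -> i \in ord e ->
  is_completion (rate A (revealed I (ev e))) i (start A I e i + residual A I e i).
Proof.
move=> en ie; have J_inst := revealed_instance (ev e) I_inst.
have eJ : (e < size (release_times (revealed I (ev e))))%N.
  by rewrite size_release_times_revealed.
have iJ : i \in order_at A (revealed I (ev e)) e by rewrite order_at_revealed.
have last : (e.+1 < size (release_times (revealed I (ev e))))%N ->
    residual A (revealed I (ev e)) e.+1 i = 0.
  by rewrite size_release_times_revealed// ltnn.
have := completion_finish A_class J_inst eJ iJ last.
have [_ ->] := slot_gt0 A_class J_inst eJ iJ last.
by rewrite start_revealed// residual_revealed.
Qed.

(** A busy period ends in phase [e]: the jobs revealed so far are all completed by the next release,
    or there is no next release. *)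
Definition closing e := (e.+1 < n)%N ==> all (fun i => q e.+1 i == 0) (revealed I (ev e)).

Definition busy_end k := (k + find (fun d => closing (k + d)) (iota 0 n))%N.

Lemma busy_endP k : (k < n)%N ->
  [/\ (k <= busy_end k)%N, (busy_end k < n)%N, closing (busy_end k)
    & forall m, (k <= m < busy_end k)%N -> ~~ closing m].
Proof.
(* The last phase is always closing, so the search succeeds within [n] offsets. *)
move=> kn; have Pd : closing (k + (n.-1 - k)).
  have n0 : (0 < n)%N by exact: leq_ltn_trans kn.
  by rewrite /closing subnKC ?prednK ?ltnn// -ltnS prednK.
have dn : (n.-1 - k < n)%N by lia.
have hs : has (fun d => closing (k + d)) (iota 0 n).
  by apply/hasP; exists (n.-1 - k)%N; rewrite // mem_iota add0n.
have fn := hs; rewrite has_find size_iota in fn.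
have bef m : (m < find (fun d => closing (k + d)) (iota 0 n))%N -> ~~ closing (k + m).
  move=> mf; have := before_find 0 mf; rewrite nth_iota ?add0n; last exact: ltn_trans fn.
  by move=> ->.
split.
- exact: leq_addr.
- rewrite /busy_end; apply: (@leq_ltn_trans (k + (n.-1 - k))); last by lia.
  by rewrite leq_add2l leqNgt; apply/negP => /bef; rewrite Pd.
- by have := nth_find 0 hs; rewrite nth_iota ?add0n.
- by move=> m /andP[km me]; rewrite -(subnKC km); apply: bef; rewrite /busy_end in me; lia.
Qed.

Lemma busy_end_eq k m : (k <= m)%N -> (m <= busy_end k)%N -> (k < n)%N ->
  busy_end m = busy_end k.
Proof.
move=> km mk kn; have [_ ek ck nk] := busy_endP kn.
have [me em cm nm] := busy_endP (leq_ltn_trans mk ek).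
case: (ltngtP (busy_end m) (busy_end k)) => // lt.
  by have := nk (busy_end m); rewrite (leq_trans km me) lt cm => /(_ isT).
by have := nm (busy_end k); rewrite mk lt ck => /(_ isT).
Qed.

Lemma release_index_le k j : (k < n)%N -> j \in ord k -> (release_index I j <= k)%N.
Proof.
move=> kn; rewrite mem_order_at// => /and3P[_ jk jI]; rewrite leqNgt; apply/negP.
move=> /event_lt/(_ (release_index_lt jI)).
by rewrite event_release_index// ltNge jk.
Qed.

(** Had the busy period in which [j] was released closed before phase [k], the residual of [j] would
    be 0 from then on. Jobs processed in one phase thus keep values assigned at the same release
    time. *)
Lemma busy_end_order k j : (k < n)%N -> j \in ord k ->
  busy_end (release_index I j) = busy_end k.
Proof.
move=> kn jk; have rk := release_index_le kn jk.
move: jk; rewrite mem_order_at// => /and3P[qj _ jI].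
have rn := release_index_lt jI.
apply/esym/busy_end_eq => //; rewrite leqNgt; apply/negP => ek.
have [re en ce _] := busy_endP rn.
have en1 := leq_ltn_trans ek kn.
move: ce => /implyP/(_ en1)/allP/(_ j).
rewrite mem_filter jI andbT -(event_release_index jI) event_le// => /(_ isT)/eqP q0.
by have := residual_nonincr A_class I_inst jI ek kn; rewrite q0 leNgt qj.
Qed.

Variable g : R -> R.
Hypothesis g_ge0 : forall u : R, 0 <= u -> 0 <= g u.
Variable lam : R -> job R -> R.
Hypothesis lam_ge0 : forall e j, (e < n)%N -> j \in revealed I (ev e) ->
  0 <= lam (ev e) j.
Hypothesis lam_Q1 : forall e, (e < n)%N -> Q1 g A (lam (ev e)) I (ev e).
Hypothesis lam_Q2 : forall e, (e < n)%N -> Q2 g A (lam (ev e)) I (ev e).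
Hypothesis lam_Q3 : forall e, (e < n)%N -> Q3 g A (lam (ev e)) I (ev e).

(* Q3 only controls the values assigned at the current release, so values
   assigned after an idle period may leave [gamma] positive inside it.  Each
   job therefore keeps the value assigned at the last release time of its
   busy period. *)
Definition final_lam j : R := lam (ev (busy_end (release_index I j))) j.

Lemma final_lam_ge0 j : j \in I -> 0 <= final_lam j.
Proof.
move=> jI; have rn := release_index_lt jI; have [re en _ _] := busy_endP rn.
apply: lam_ge0 => //; rewrite mem_filter jI andbT -(event_release_index jI).
exact: event_le.
Qed.

Lemma in_slot_revealed e k i t : (e < n)%N -> (k <= e)%N -> in_slot k i t ->
  scheduled A (revealed I (ev e)) i t.
Proof.
move=> en ke h; have ik := in_slot_order h; move: h; rewrite /in_slot => /andP[st].
rewrite /finish ik => tf; apply/existsP.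
have ks : (k < size (release_times (revealed I (ev e))))%N.
  by rewrite size_release_times_revealed.
exists (Ordinal ks); rewrite /= start_revealed// residual_revealed//.
rewrite order_at_revealed// ik st size_release_times_revealed// ltnS /=.
apply/andP; split; first by move: tf; case: ifP => // _; rewrite le_min => /andP[].
apply/implyP => ke'; rewrite event_revealed//.
by move: tf; rewrite (leq_ltn_trans ke' en) le_min => /andP[].
Qed.

(** Up to the [e]-th release Q2 speaks of the actual run; from then on Q1 speaks of the run on the
    revealed jobs, whose slots contain the actual ones. *)
Lemma slot_dominates k e i t : (k <= e)%N -> (e < n)%N -> in_slot k i t ->
  dominates g (lam (ev e)) (revealed I (ev e)) i t.
Proof.
move=> ke en h; have kn := leq_ltn_trans ke en.
have iJ : i \in revealed I (ev e).
  move: (in_slot_order h); rewrite mem_order_at// mem_filter => /and3P[_ ik ->].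
  by rewrite (le_trans ik)// event_le.
have [te|et] := ltP t (ev e).
  apply: (lam_Q2 en).1 => //; rewrite scheduledE; apply/existsP.
  by exists (Ordinal kn).
by apply: lam_Q1 => //; apply: in_slot_revealed h.
Qed.

Lemma idle_gamma_job e j t : (e < n)%N -> j \in revealed I (ev e) -> 0 < t ->
  release j <= t ->
  (forall i, i \in ord e -> start A I e i + q e i < t) ->
  gamma_job g (lam (ev e)) j t <= 0.
Proof.
move=> en jJ t0 jt idle.
have <- : gamma g (lam (ev e)) (revealed I (ev e)) t = 0.
  have := lam_Q3 en; rewrite /Q3 /= => /(_ (fun i => start A I e i + q e i)).
  apply=> [i|].
    rewrite -(perm_mem (order_at_perm A_class I_inst en)) => ie.
    exact: completion_revealed.
  (* The maximum starts from 0, hence the assumption [0 < t]. *)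
  rewrite big_seq; elim/big_ind: _ => [//|x y xt yt|i].
    by rewrite gt_max xt yt.
  by rewrite -(perm_mem (order_at_perm A_class I_inst en)) => /idle.
exact: (le_bigmax_seq 0 j _ (fun i => gamma_job g (lam (ev e)) i t)).
Qed.

(** Either a job [i] of the busy period of [j] is processed at [t], and [final_lam i] alone
    dominates, or all work known at the closing phase [e] is finished before [t] and Q3 applies. *)
Lemma dual_bound j t : j \in I -> release j < t ->
  gamma_job g final_lam j t <= \sum_(i <- I) final_lam i * rate A I i t.
Proof.
move=> jI jt; have rn := release_index_lt jI.
have [re en ce nc] := busy_endP rn.
set e := busy_end (release_index I j) in re en ce nc.
have jJ : j \in revealed I (ev e).
  by rewrite mem_filter jI -(event_release_index jI) event_le.
have t0 : 0 < t by have [_ /(_ _ jI)[r0 _ _]] := I_inst; exact: le_lt_trans jt.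
have sum_ge0 : 0 <= \sum_(i <- I) final_lam i * rate A I i t.
  by rewrite big_seq sumr_ge0// => i iI; rewrite mulr_ge0 ?final_lam_ge0.
have rjt : ev (release_index I j) < t by rewrite event_release_index.
have [k [kn rk kt tk]] := phase_exists rn rjt.
have idle : (forall i, i \in ord e -> start A I e i + q e i < t) ->
    gamma_job g final_lam j t <= \sum_(i <- I) final_lam i * rate A I i t.
  by move=> h; apply: le_trans sum_ge0; apply: idle_gamma_job h => //; exact: ltW.
have [ke|ek] := leqP k e; last first.
  (* Here [t] lies after the busy period of [j]: phase [e] is closing, so its slots end by the next
     release, which precedes [t]. *)
  apply: idle => i ie; have en1 := leq_ltn_trans ek kn.
  move: (ie); rewrite mem_order_at// => /and3P[_ re' iI].
  have iq : (e.+1 < n)%N -> q e.+1 i = 0.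
    move: ce => /implyP ce /ce/allP/(_ i).
    by rewrite mem_filter re' iI => /(_ isT)/eqP.
  have [_ <-] := slot_gt0 A_class I_inst en ie iq.
  apply: le_lt_trans (finish_le en1 ie) _.
  exact: le_lt_trans (event_le ek kn) kt.
have ek : busy_end k = e by exact: busy_end_eq.
have [[i ikt]|done] := busy_or_done A_class I_inst kn kt tk.
  have ik := in_slot_order ikt.
  have iI : i \in I by move: ik; rewrite mem_order_at// => /and3P[].
  have ei := busy_end_order kn ik; rewrite ek in ei.
  have [_ dom] := slot_dominates ke en ikt.
  have rate1 : rate A I i t = 1.
    rewrite /rate scheduledE; suff -> : [exists k : 'I_n, in_slot k i t] by [].
    by apply/existsP; exists (Ordinal kn).
  apply: (@le_trans _ _ (final_lam i)).
    (* Domination concerns the other jobs; for [i] itself the bound comes from [g_ge0]. *)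
    have [->|ji] := eqVneq j i; last by rewrite /final_lam ei; exact: dom.
    rewrite /gamma_job gerBl; apply: mulr_ge0.
      have [_ /(_ _ iI)[_ pi wi]] := I_inst.
      by rewrite divr_ge0// ltW.
    rewrite g_ge0// subr_ge0.
    move: (in_slot_event A_class I_inst kn ikt) ik => [/ltW h _].
    by rewrite mem_order_at// => /and3P[_ /le_trans->].
  rewrite (big_rem i)//= rate1 mulr1 lerDl big_seq sumr_ge0// => l /mem_rem lI.
  by rewrite mulr_ge0 ?final_lam_ge0.
(* The processor is idle at [t], so all revealed jobs are completed; then [k] is closing, and
   minimality of [e] gives [k = e]. *)
have ck : closing k.
  apply/implyP => kn1; apply/allP => i; rewrite mem_filter => /andP[ik iI].
  have [|] := boolP (i \in ord k); first by move/done => [_ /(_ kn1)/eqP].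
  rewrite mem_order_at// ik iI !andbT -leNgt => qi.
  rewrite eq_le residual_ge0// andbT.
  exact: le_trans (residual_nonincr A_class I_inst iI (leqnSn k) kn1) qi.
apply: idle; suff <- : k = e by move=> i /done[].
apply/eqP; rewrite eqn_leq ke leqNgt; apply/negP => lke.
by have := nc k; rewrite rk lke ck => /(_ isT).
Qed.

(** Slots are right-closed, so [j] is still scheduled at its completion time, where its [gamma_job]
    is nonnegative. *)
Lemma completion_bound j k : j \in I -> (k < n)%N -> j \in ord k ->
  ((k.+1 < n)%N -> q k.+1 j = 0) ->
  density j * g (finish k j - release j) <= final_lam j.
Proof.
move=> jI kn jk done; have [ke en _ _] := busy_endP kn.
have [st fE] := slot_gt0 A_class I_inst kn jk done.
have : in_slot k j (finish k j) by rewrite /in_slot lexx andbT fE.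
move/(slot_dominates ke en) => [+ _].
by rewrite /gamma_job subr_ge0 /final_lam (busy_end_order kn jk).
Qed.

End BusyPeriods.

(** * Integrals of weighted sums of rates *)

Section LinearCombination.
Set Implicit Arguments.
Unset Strict Implicit.
Variables (R : realType) (T : eqType).
Local Notation mu := lebesgue_measure.
Variables (s : seq T) (a c : T -> R) (f : T -> R -> R).
Hypothesis a_ge0 : forall j, j \in s -> 0 <= a j.
Hypothesis f_ge0 : forall j t, j \in s -> 0 <= f j t.
Hypothesis f_meas : forall j, j \in s -> measurable_fun setT (f j).
Hypothesis f_int : forall j, j \in s ->
  (\int[mu]_u (f j u)%:E = (c j)%:E)%E.

Lemma lincomb_ge0 t : 0 <= \sum_(j <- s) a j * f j t.
Proof. by rewrite big_seq sumr_ge0// => j js; rewrite mulr_ge0 ?a_ge0 ?f_ge0. Qed.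

Lemma measurable_lincomb : measurable_fun setT (fun t => \sum_(j <- s) a j * f j t).
Proof.
(* The hypotheses hold only for members of [s], while [measurable_sum] wants every term measurable;
   the guard makes the other terms 0. *)
rewrite (_ : (fun t => _) =
    fun t => \sum_(j <- s) if j \in s then a j * f j t else 0); last first.
  by apply/funext => t; rewrite big_seq big_mkcond.
apply: (measurable_sum _ (h := fun j t => if j \in s then a j * f j t else 0)) => j.
have [js|_] := boolP (j \in s); last exact: measurable_cst.
by apply: measurable_funM; [exact: measurable_cst|exact: f_meas].
Qed.

Lemma integral_lincomb :
  (\int[mu]_u (\sum_(j <- s) a j * f j u)%:E = (\sum_(j <- s) a j * c j)%:E)%E.
Proof.
under eq_integral do rewrite big_seq big_mkcond -sumEFin.
rewrite ge0_integral_sum//.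
- rewrite [in RHS]big_seq [in RHS]big_mkcond -sumEFin; apply: eq_bigr => j _.
  have [js|_] := boolP (j \in s); last by rewrite integral0.
  under eq_integral do rewrite EFinM.
  rewrite ge0_integralZl ?f_int ?EFinM ?lee_fin ?a_ge0//.
    by apply/measurable_EFinP; exact: f_meas.
  by move=> t _; rewrite lee_fin f_ge0.
- move=> j; apply/measurable_EFinP; have [js|_] := boolP (j \in s); last exact: measurable_cst.
  by apply: measurable_funM; [exact: measurable_cst|exact: f_meas].
- by move=> j t _; rewrite lee_fin; case: ifP => // js; rewrite mulr_ge0 ?a_ge0 ?f_ge0.
Qed.

End LinearCombination.

(** * Weak duality against an offline schedule *)

Section WeakDuality.
Set Implicit Arguments.
Unset Strict Implicit.
Variables (R : realType) (I : seq (job R)) (I_inst : instance I).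
Variables (g : R -> R).
Hypothesis g_ge0 : forall u : R, 0 <= u -> 0 <= g u.
Hypothesis g_mono : forall u v : R, 0 <= u -> u <= v -> g u <= g v.
Variables (s : R) (x : job R -> R -> R) (D : job R -> R).
Hypothesis x_sched : is_schedule s I x.
Hypothesis x_compl : forall j, j \in I -> is_completion x j (D j).
Local Notation mu := lebesgue_measure.
Implicit Types (j : job R) (t : R).

(** The left end is open because the dual constraint is available only strictly after the release;
    one point carries no volume. *)
Definition truncated j t : R := x j t * \1_[set` `]release j, D j]] t.

Lemma truncated_ge0 j t : j \in I -> 0 <= truncated j t.
Proof. by case: x_sched => _ x0 _ _ jI; rewrite mulr_ge0// x0. Qed.

Lemma measurable_truncated j : j \in I -> measurable_fun setT (truncated j).
Proof.
case: x_sched => mx _ _ _ jI; apply: measurable_funM; first exact: mx.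
by apply: measurable_indic; exact: measurable_itv.
Qed.

Lemma sum_truncated_le t : \sum_(j <- I) truncated j t <= s.
Proof.
case: x_sched => _ x0 _ xs; apply: le_trans (xs t).
rewrite big_seq [leRHS]big_seq; apply: ler_sum => j jI.
by rewrite /truncated indicE ler_piMr ?x0// lern1 leq_b1.
Qed.

Lemma integral_truncated j : j \in I ->
  (\int[mu]_u (truncated j u)%:E = (proc j)%:E)%E.
Proof.
move=> jI; have [_ <- _] := x_compl jI; case: x_sched => mx _ _ _.
rewrite /volume -integral_itv_obnd_cbnd; last first.
  by apply/measurable_EFinP/measurable_funTS; exact: mx.
rewrite [RHS]integral_mkcond; apply: eq_integral => t _.
rewrite patchE /truncated indicE.
by case: ifP => _; rewrite ?mulr1 ?mulr0.
Qed.

(* Integrating the dual constraints against the schedule truncated to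
   [release j, D j], where the delay cost is at most its value at [D j],
   avoids any measurability assumption on [g]. *)
Lemma weak_duality (lam : job R -> R) (G : R -> R) (V : R) :
  (forall j, j \in I -> 0 <= lam j) -> (forall t, 0 <= G t) ->
  measurable_fun setT G ->
  (\int[mu]_u (G u)%:E = V%:E)%E ->
  (forall j t, j \in I -> release j < t -> gamma_job g lam j t <= G t) ->
  0 <= s ->
  \sum_(j <- I) lam j * proc j <= cost g I D + s * V.
Proof.
move=> lam0 G0 mG intG dual s0; have [_ Ipos] := I_inst.
have rD j : j \in I -> release j <= D j by move=> /x_compl[].
pose d j := density j * g (D j - release j).
have dens0 j : j \in I -> 0 <= density j.
  by move=> /Ipos[_ /ltW pj /ltW wj]; exact: divr_ge0.
have d0 j : j \in I -> 0 <= d j.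
  by move=> jI; rewrite mulr_ge0 ?dens0// g_ge0// subr_ge0 rD.
have -> : cost g I D = \sum_(j <- I) d j * proc j.
  rewrite /cost big_seq [RHS]big_seq; apply: eq_bigr => j /Ipos[_ pj _].
  by rewrite /d /density mulrAC divfK// gt_eqF.
rewrite -lee_fin EFinD EFinM -intG.
rewrite -(integral_lincomb lam0 truncated_ge0 measurable_truncated integral_truncated).
rewrite -(integral_lincomb d0 truncated_ge0 measurable_truncated integral_truncated).
have msG : measurable_fun setT (fun t => s * G t).
  by apply: measurable_funM => //; exact: measurable_cst.
have -> : (s%:E * \int[mu]_u (G u)%:E = \int[mu]_u (s * G u)%:E)%E.
  under [RHS]eq_integral do rewrite EFinM.
  rewrite ge0_integralZl ?lee_fin//; first exact/measurable_EFinP.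
  by move=> t _; rewrite lee_fin.
have mT := measurable_truncated.
rewrite -ge0_integralD//; last 4 first.
- by move=> t _; rewrite lee_fin (lincomb_ge0 d0 truncated_ge0).
- by apply/measurable_EFinP; apply: measurable_lincomb.
- by move=> t _; rewrite lee_fin mulr_ge0.
- exact/measurable_EFinP.
apply: ge0_le_integral => //.
- by move=> t _; rewrite lee_fin (lincomb_ge0 lam0 truncated_ge0).
- by apply/measurable_EFinP; apply: measurable_lincomb.
- under eq_fun do rewrite -EFinD.
  by apply/measurable_EFinP; apply: measurable_funD => //; apply: measurable_lincomb.
move=> t _; rewrite lee_fin.
(* The dual constraints are summed with weights [truncated j t]; the speed bound then replaces the
   total rate in front of [G t] by [s]. *)
apply: (@le_trans _ _ (\sum_(j <- I) d j * truncated j t + (\sum_(j <- I) truncated j t) * G t)).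
  rewrite mulr_suml -big_split /= big_seq [leRHS]big_seq; apply: ler_sum => j jI.
  rewrite [_ * G t]mulrC -mulrDl.
  have [tj|tj] := boolP (t \in `]release j, D j]); last first.
    by rewrite /truncated indicE mem_setE (negbTE tj) !mulr0.
  apply: ler_wpM2r; first exact: truncated_ge0.
  move: tj; rewrite in_itv /= => /andP[rt tD].
  have := dual _ _ jI rt; rewrite /gamma_job lerBlDl => /le_trans; apply.
  by rewrite lerD2r; apply: ler_wpM2l; [exact: dens0|apply: g_mono; lra].
by rewrite lerD2l ler_wpM2r// sum_truncated_le.
Qed.

End WeakDuality.

(** * Assembly of the competitive bound *)

Theorem theorem13 (R : realType) (g : R -> R)
  (g_ge0 : forall u : R, 0 <= u -> 0 <= g u)
  (g_mono : forall u v : R, 0 <= u -> u <= v -> g u <= g v)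
  (g0 : g 0 = 0)
  (A : algorithm R) (A_class : in_class A)
  (A_dual : forall I : seq (job R), instance I ->
    exists lam : R -> job R -> R,
      (forall z : job R, z \in I ->
        let tau := release z in
        [/\ forall j : job R, j \in revealed I tau -> 0 <= lam tau j,
            Q1 g A (lam tau) I tau,
            Q2 g A (lam tau) I tau
          & Q3 g A (lam tau) I tau]) /\
      dual_feasible g (lam (last_release I)) I
        (gamma g (lam (last_release I)) I))
  (eps : R) (eps_gt0 : 0 < eps) :
  competitive g A (1 + eps) ((1 + eps) / eps).
Proof.
move=> I I_inst; have [lam [lamQ _]] := A_dual I I_inst.
have Q e : (e < size (release_times I))%N ->
    [/\ forall j, j \in revealed I (event I e) -> 0 <= lam (event I e) j,
        Q1 g A (lam (event I e)) I (event I e),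
        Q2 g A (lam (event I e)) I (event I e)
      & Q3 g A (lam (event I e)) I (event I e)].
  by move=> /event_release[z zI <-]; exact: lamQ.
have lam0 e j : (e < size (release_times I))%N ->
    j \in revealed I (event I e) -> 0 <= lam (event I e) j.
  by move=> /Q[+ _ _ _]; apply.
have q1 e : (e < size (release_times I))%N -> Q1 g A (lam (event I e)) I (event I e).
  by case/Q.
have q2 e : (e < size (release_times I))%N -> Q2 g A (lam (event I e)) I (event I e).
  by case/Q.
have q3 e : (e < size (release_times I))%N -> Q3 g A (lam (event I e)) I (event I e).
  by case/Q.
pose L := final_lam A I lam.
have L0 j : j \in I -> 0 <= L j by exact: final_lam_ge0.
have /choice[C CP] j : exists C, j \in I -> is_completion (rate A I) j C /\
    density j * g (C - release j) <= L j.
  have [jI|_] := boolP (j \in I); last by exists 0.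
  have [k [kn jk kdone]] := exists_completion A_class I_inst jI.
  exists (finish A I k j) => _; split; first exact: completion_finish.
  exact: completion_bound.
exists C; split=> [j /CP[]//|x D x_sched x_compl].
have [_ Ipos] := I_inst.
have costC : cost g I C <= \sum_(j <- I) L j * proc j.
  rewrite /cost big_seq [leRHS]big_seq; apply: ler_sum => j jI.
  have [_ pj _] := Ipos _ jI.
  have [_ /(ler_wpM2r (ltW pj))] := CP _ jI.
  by rewrite /density mulrAC divfK// gt_eqF.
have rate_ge0 j t : j \in I -> 0 <= rate A I j t by rewrite /rate ler0n.
have mrate j : j \in I -> measurable_fun setT (rate A I j).
  by move=> _; exact: measurable_rate.
have irate j (_ : j \in I) := integral_rate_total A_class I_inst j.
have s0 : 0 <= (1 + eps)^-1 by rewrite invr_ge0; lra.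
have := weak_duality I_inst g_ge0 g_mono x_sched x_compl L0
  (lincomb_ge0 L0 rate_ge0) (measurable_lincomb L mrate)
  (integral_lincomb L0 rate_ge0 mrate irate)
  (fun j t => @dual_bound _ _ A_class _ I_inst _ g_ge0 _ lam0 q1 q2 q3 j t) s0.
have : \sum_(j <- I) L j * \sum_(k < size (release_times I)) slot_length A I k j <=
    \sum_(j <- I) L j * proc j.
  rewrite big_seq [leRHS]big_seq; apply: ler_sum => j jI.
  by rewrite ler_wpM2l ?L0// sum_slot_length_le.
(* [V] is the integral of the substitute for [gamma]. Weak duality reads
   [W <= cost g I D + V / (1 + eps)], and [V <= W]. *)
move: costC; set W := \sum_(j <- I) _ * proc j; set V := \sum_(j <- I) _ * _.
move=> costC /(ler_wpM2l s0) VW WD; apply: (le_trans costC).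
have {VW WD} WD := le_trans WD (lerD (lexx _) VW).
have e0 : eps != 0 by rewrite gt_eqF.
have e1 : 1 + eps != 0 by rewrite gt_eqF// addr_gt0.
(* The competitive ratio is the inverse of [1 - 1 / (1 + eps)]. *)
have -> : W = (1 + eps) / eps * (W - (1 + eps)^-1 * W).
  by field; rewrite e0 e1.
by rewrite ler_wpM2l ?lerBlDr// divr_ge0// ?addr_ge0// ltW.
Qed.
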